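(* Let $x^0\in X$, let $B\ge k$ be the bundle size of the limited-memory proximal bundle method (LM-PBM), and let $0<\varepsilon<f(x^0)-f^*$. Set $\beta=1/2$ and choose $\rho\in[\min\{\mu^*,L\},\max\{\mu^*,L\}]$. Let $\gamma_\rho:=1-\beta/\max\{2,4\rho/\mu^*\}$ and $\theta_\rho:=L/(L+(1-\beta)\rho)$. Then LM-PBM with inputs $x^0,\rho,\beta,B$ reaches a serious center $x^t$ satisfying $f(x^t)-f^*\le\varepsilon$ after at most $$T_\varepsilon^{\text{LM-PBM}}=O\Bigg(B\left(1+\frac{L}{\mu^*}\right)\left[1+\log\frac{f(x^0)-f^*}{\varepsilon\min\{1,\mu^*/\rho\}}\right]+B\left(1+\frac L\rho\right)\log\frac{2\|g(x^0)\|^2}{\min\{\rho,\mu^*\}\varepsilon}\Bigg)$$ first-order oracle calls. In particular: (i) If $\rho=\mu^*$, then $\gamma_{\mu^*}=7/8$ and $\theta_{\mu^*}=L/(L+\mu^*/2)$, and the bound becomes $$T_\varepsilon^{\text{LM-PBM}}=O\left(B\left(1+\frac L{\mu^*}\right)\left[1+\log\frac{f(x^0)-f^*}{\varepsilon}+\log\frac{2\|g(x^0)\|^2}{\mu^*\varepsilon}\right]\right).$$ (ii) If $\rho=L$, then $\theta_L=2/3$ and $\gamma_L=1-1/(2\max\{2,4L/\mu^*\})$, and the bound becomes $$T_\varepsilon^{\text{LM-PBM}}=O\Bigg(B\left(1+\frac L{\mu^*}\right)\left[1+\log\frac{(1+L/\mu^* )(f(x^0)-f^* )}{\varepsilon}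\right]+B\log\frac{2\|g(x^0)\|^2}{\min\{L,\mu^*\}\varepsilon}\Bigg).$$
   Context: Setting. $X\subseteq\mathbb R^n$ is a nonempty closed convex set, $f:X\to\mathbb R$ is convex, lower semicontinuous and attains its minimum $f^*=\min_{X}f$; $X^*=\operatorname{argmin}_X f$. $\|\cdot\|$, $\langle\cdot,\cdot\rangle$ are the Euclidean norm and inner product. For $x\in X$, $\partial f(x)=\{v\in\mathbb R^n: f(z)\ge f(x)+\langle v,z-x\rangle\ \forall z\in X\}$. A first-order oracle returns, at any $u\in X$, $f(u)$ and a subgradient $g(u)\in\partial f(u)$; $\ell_f(x;u):=f(u)+\langle g(u),x-u\rangle$ is the corresponding cutting plane. Piecewise smoothness. $k\in\mathbb N_+$, $L>0$, and $f$ is $(k,L)$-piecewise smooth: there are $k$ subsets $X_1,\dots,X_k$ of $X$ (pieces) covering $X$ such that each restriction $f|_{X_i}$ is $L$-smooth; this is used together with the oracle assumption that $f(x)-\ell_f(x;\bar x)\le\frac L2\|x-\bar x\|^2$ for all $i\in\{1,\dots,k\}$ and all $x,\bar x\in X_i$. Quadratic growth. $\mu^*:=\sup\{\nu>0: f(x)-f^*\ge\frac\nu2\operatorname{dist}^2(x,X^* )\ \forall x\in X\}$, and $0<\mu^*<\infty$ is assumed. LM-PBM. Input $x^0\in X$, $\rho>0$, $\beta\in(0,1)$, integer bundle size $B$. Set $\psi^0=\ell_f(\cdot;x^0)$ and $b=0$. For $t=0,1,\dots$ do one step: compute $y^t=\operatorname{argmin}_{x\in X}\{\psi^t(x)+\frac\rho2\|x-x^t\|^2\}$.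 If $f(x^t)-f(y^t)\ge\beta(f(x^t)-\psi^t(y^t))$, iteration $t$ is a serious step and $x^{t+1}=y^t$; otherwise it is a null step and $x^{t+1}=x^t$. If iteration $t$ is serious or $b=B$ (compression), set $a^t(x)=\psi^t(y^t)+\rho\langle x^t-y^t,x-y^t\rangle$, $\psi^{t+1}(x)=\max\{a^t(x),\ell_f(x;x^{t+1}),\ell_f(x;y^t)\}$, and $b\leftarrow0$. Otherwise set $\psi^{t+1}(x)=\max\{\psi^t(x),\ell_f(x;y^t)\}$ and $b\leftarrow b+1$. A serious center is a center $x^t$ produced by a serious step. The oracle is called once at $x^0$ and once at each trial point $y^t$. $O(\cdot)$ hides an absolute constant. *)

(* Defs.v *)
From HB Require Import structures.
From mathcomp Require Import all_boot all_order all_algebra.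
From mathcomp Require Import all_classical all_reals all_analysis.

Set Implicit Arguments.
Unset Strict Implicit.
Unset Printing Implicit Defensive.

Import Order.TTheory GRing.Theory Num.Theory.
Import numFieldNormedType.Exports.

Local Open Scope classical_set_scope.
Local Open Scope ring_scope.

Section Euclidean.
Variables (R : realType) (n : nat).
Implicit Types (u v : 'rV[R]_n) (A : set 'rV[R]_n).

Definition dot u v : R := \sum_(i < n) u 0 i * v 0 i.

(* The library norm on 'rV[R]_n is the sup norm; it induces the same topology,
   so [closed] and [nbhs] below are the Euclidean ones. *)
Definition enorm u : R := Num.sqrt (dot u u).

Definition edist_set u A : R := inf [set enorm (u - a) | a in A].

End Euclidean.

(* A function f : X -> R is represented by a total function on 'rV[R]_n of which
   only the values on X are used. *)
Section ConvexOptimization.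
Variables (R : realType) (n : nat).
Implicit Types (X : set 'rV[R]_n) (f : 'rV[R]_n -> R).
Implicit Types (g : 'rV[R]_n -> 'rV[R]_n) (x u v z : 'rV[R]_n).

Definition lsc_on X f : Prop :=
  forall x a, X x -> a < f x -> \forall z \near within X (nbhs x), a < f z.

Definition argmin X f : set 'rV[R]_n :=
  [set x | X x /\ forall z, X z -> f x <= f z].

Definition min_value X f : R := inf [set f x | x in X].

Definition subdifferential X f x : set 'rV[R]_n :=
  [set v | forall z, X z -> f x + dot v (z - x) <= f z].

Definition subgradient_oracle X f g : Prop :=
  forall u, X u -> subdifferential X f u (g u).

Definition cutting_plane f g u x : R := f u + dot (g u) (x - u).

(* f restricted to S is differentiable (relative to S) with an L-Lipschitz
   gradient; S is arbitrary, so the gradient is a choice G of one of the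
   possibly many relative gradients. *)
Definition smooth_on (L : R) (S : set 'rV[R]_n) f : Prop :=
  exists2 G : 'rV[R]_n -> 'rV[R]_n,
    forall x, S x -> forall e, 0 < e ->
      \forall z \near within S (nbhs x),
        `|f z - f x - dot (G x) (z - x)| <= e * enorm (z - x) &
    forall x z, S x -> S z -> enorm (G x - G z) <= L * enorm (x - z).

Definition piecewise_smooth X f (k : nat) (L : R)
    (P : 'I_k -> set 'rV[R]_n) : Prop :=
  [/\ forall i, P i `<=` X,
      X `<=` \bigcup_i P i &
      forall i, smooth_on L (P i) f].

Definition piecewise_oracle_bound f g (k : nat) (L : R)
    (P : 'I_k -> set 'rV[R]_n) : Prop :=
  forall i x u, P i x -> P i u ->
    f x - cutting_plane f g u x <= L / 2 * enorm (x - u) ^+ 2.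

Definition quadratic_growth X f (nu : R) : Prop :=
  forall x, X x ->
    nu / 2 * edist_set x (argmin X f) ^+ 2 <= f x - min_value X f.

Definition growth_modulus X f : \bar R :=
  ereal_sup [set nu%:E | nu in [set nu : R | 0 < nu /\ quadratic_growth X f nu]].

End ConvexOptimization.

Section LMPBM.
Variables (R : realType) (n : nat).
Variables (X : set 'rV[R]_n) (f : 'rV[R]_n -> R) (g : 'rV[R]_n -> 'rV[R]_n).
Variables (rho beta : R) (B : nat).

Record bundle_state := BundleState {
  center : 'rV[R]_n;
  model : 'rV[R]_n -> R;
  counter : nat
}.

Implicit Types (s : bundle_state) (x y z : 'rV[R]_n).

Definition prox_trial s y : Prop :=
  argmin X (fun z => model s z + rho / 2 * enorm (z - center s) ^+ 2) y.

Definition serious s y : bool :=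
  beta * (f (center s) - model s y) <= f (center s) - f y.

Definition aggregate s y z : R :=
  model s y + rho * dot (center s - y) (z - y).

Definition lmpbm_step s y : bundle_state :=
  let x := if serious s y then y else center s in
  if serious s y || (counter s == B) then
    BundleState x
      (fun z => Num.max (aggregate s y z)
                  (Num.max (cutting_plane f g x z) (cutting_plane f g y z))) 0
  else
    BundleState x
      (fun z => Num.max (model s z) (cutting_plane f g y z)) (counter s).+1.

(* s t is the state at the start of iteration t, and y t its trial point. *)
Definition lmpbm_run x0 (s : nat -> bundle_state) (y : nat -> 'rV[R]_n) : Prop :=
  s 0%N = BundleState x0 (cutting_plane f g x0) 0 /\
  forall t, prox_trial (s t) (y t) /\ s t.+1 = lmpbm_step (s t) (y t).

Definition serious_center (s : nat -> bundle_state) (y : nat -> 'rV[R]_n)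
    (t : nat) : Prop :=
  exists2 r, t = r.+1 & serious (s r) (y r).

(* The points at which the oracle has been called once the center of s t is
   known, i.e. after iterations 0, ..., t - 1. *)
Definition oracle_queries x0 (y : nat -> 'rV[R]_n) (t : nat) : seq 'rV[R]_n :=
  x0 :: mkseq y t.

Definition reaches_within x0 (s : nat -> bundle_state) (y : nat -> 'rV[R]_n)
    (eps T : R) : Prop :=
  exists t, [/\ serious_center s y t,
                f (center (s t)) - min_value X f <= eps &
                (size (oracle_queries x0 y t))%:R <= T].

End LMPBM.

Definition gamma_rate (R : realType) (beta mu rho : R) : R :=
  1 - beta / Num.max 2 (4 * rho / mu).

Definition theta_rate (R : realType) (beta L rho : R) : R :=
  L / (L + (1 - beta) * rho).

(* Main.v *)
Require Import Defs.
From HB Require Import structures.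
From mathcomp Require Import all_boot all_order all_algebra.
From mathcomp Require Import all_classical all_reals all_analysis.
From mathcomp Require Import ring lra.

Set Implicit Arguments.
Unset Strict Implicit.
Unset Printing Implicit Defensive.

Import Order.TTheory GRing.Theory Num.Theory.
Import numFieldNormedType.Exports.
Local Open Scope classical_set_scope.
Local Open Scope ring_scope.

(** Every measure of progress is expressed through the prox gap of an iteration,
    [gap t = f (x_t) - min_X (psi_t + rho/2 |. - x_t|^2)], and the objective gap
    [obj t = f (x_t) - f^*].

    Quadratic growth bounds [obj t] by [M * gap t] with
    [M = max (2, 4 rho / mu)]: the model lies below [f], so moving from the
    center towards a minimizer by the best step makes the prox objective at
    least [obj t / M] smaller than [f (x_t)] ([prox_gap_lower]).

    A serious step decreases [obj] by the factor [gamma]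
    ([serious_decrease]), but may increase the prox gap. The increase is by a
    factor at most 2 when beta = 1/2, since the aggregate plane survives in
    the new model ([prox_gap_serious]).

    Null steps never increase the prox gap, and [B + 1] of them in a row decrease
    it by the factor [theta] ([gap_full_null_streak]). Indeed, among the
    [B + 1 > k] trial points two, [y_i] and [y_j] with [i < j], lie in the same
    piece. The cut at [y_i] is still in the model at time [j], so the error of
    the model at [y_j] is at most [L/2 |y_j - y_i|^2]; this error is large
    because step [j] is null. By strong convexity of the prox objective the gap
    has dropped by at least [rho/2 |y_j - y_i|^2] from time [i] to time [j].
    Comparing the two estimates gives the contraction.

    The run is thus cut into blocks of at most [B + 1] iterations, each ending
    with a serious step or consisting of [B + 1] null steps. The potential
    [ln gap + 4 M ln obj] pays for the factor 2 lost at serious steps: it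
    drops by at least [1 - theta] over either kind of block
    ([potential_drop]). As long as [obj > eps] the potential can drop in total
    by at most [l2 + 4 M l1], where [l1] and [l2] are the logarithms of
    [obj 0 / eps] and of [2 |g (x_0)|^2 / (min (rho, mu) eps)]
    ([potential_range]). Charging the growth of the prox gap to the telescoping
    logarithm of [obj] is what makes the two logarithms add rather than
    multiply. Finally [M (1 + L/rho)] is [O (1 + L/mu)] because [rho] lies
    between [mu] and [L] ([mixed_ratio_le]). *)

(** * Euclidean geometry *)

Section EuclideanSpace.
Variables (R : realType) (n : nat).
Implicit Types (u v w x y z : 'rV[R]_n) (A : set 'rV[R]_n).

Lemma dotC u v : dot u v = dot v u.
Proof. by apply: eq_bigr => i _; rewrite mulrC. Qed.

Lemma dotDr u v w : dot u (v + w) = dot u v + dot u w.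
Proof. by rewrite -big_split; apply: eq_bigr => i _; rewrite mxE mulrDr. Qed.

Lemma dotZr (a : R) u v : dot u (a *: v) = a * dot u v.
Proof.
by rewrite /dot mulr_sumr; apply: eq_bigr => i _; rewrite mxE mulrCA.
Qed.

Lemma dotDl u v w : dot (u + v) w = dot u w + dot v w.
Proof. by rewrite dotC dotDr !(dotC w). Qed.

Lemma dotZl (a : R) u v : dot (a *: u) v = a * dot u v.
Proof. by rewrite dotC dotZr dotC. Qed.

Lemma dotNr u v : dot u (- v) = - dot u v.
Proof. by rewrite -scaleN1r dotZr mulN1r. Qed.

Lemma dotNl u v : dot (- u) v = - dot u v.
Proof. by rewrite dotC dotNr dotC. Qed.

Definition dotE := (dotDl, dotDr, dotNl, dotNr, dotZl, dotZr).

Lemma dot_ge0 u : 0 <= dot u u.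
Proof. by apply: sumr_ge0 => i _; rewrite -expr2 sqr_ge0. Qed.

Lemma sqr_enorm u : enorm u ^+ 2 = dot u u.
Proof. by rewrite sqr_sqrtr // dot_ge0. Qed.

Lemma sqr_enormZ (t : R) u : enorm (t *: u) ^+ 2 = t ^+ 2 * enorm u ^+ 2.
Proof. by rewrite !sqr_enorm dotZl dotZr mulrA. Qed.

Lemma sqr_enorm_subC u v : enorm (u - v) ^+ 2 = enorm (v - u) ^+ 2.
Proof. by rewrite -opprB -scaleN1r sqr_enormZ sqrrN expr1n mul1r. Qed.

Lemma sqr_enorm_sub x y z :
  enorm (z - x) ^+ 2 =
  enorm (y - x) ^+ 2 - 2 * dot (x - y) (z - y) + enorm (z - y) ^+ 2.
Proof.
rewrite !sqr_enorm !dotE (dotC z x) (dotC z y) (dotC y x); ring.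
Qed.

Lemma sqr_enorm_segment (t : R) x y z :
  enorm (y + t *: (z - y) - x) ^+ 2 =
  enorm (y - x) ^+ 2 - t * (2 * dot (x - y) (z - y)) +
  t ^+ 2 * enorm (z - y) ^+ 2.
Proof.
rewrite !sqr_enorm !dotE (dotC z x) (dotC z y) (dotC y x); ring.
Qed.

(** Turns a bound on the distance to every minimizer into one on the distance to
    the set, so that no minimizer nearest to [x] has to be exhibited. *)
Lemma le_sqr_edist_set (c : R) x A : A !=set0 ->
  (forall a, A a -> c <= enorm (x - a) ^+ 2) -> c <= edist_set x A ^+ 2.
Proof.
move=> [a Aa] cA; have [c_le0|c_gt0] := leP c 0.
  exact: le_trans (sqr_ge0 _).
have le_inf : Num.sqrt c <= edist_set x A.
  apply: lb_le_inf; first by exists (enorm (x - a)), a.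
  move=> _ [b Ab <-].
  by rewrite ler_sqrt ?dot_ge0 // -sqr_enorm cA.
rewrite -(sqr_sqrtr (ltW c_gt0)) ler_pXn2r ?nnegrE ?sqrtr_ge0//.
exact: le_trans (sqrtr_ge0 _) le_inf.
Qed.

End EuclideanSpace.

(** * Convexity, minima and growth *)

Section ConvexFunctions.
Variables (R : realType) (n : nat).
Implicit Types (X : set 'rV[R]_n) (f h psi : 'rV[R]_n -> R) (x y z : 'rV[R]_n).

(** Convexity on the whole space along segments given by a base point and a
    direction, the form in which the first-order argument at a prox point
    uses it. *)
Definition segment_convex psi := forall x z (t : R), 0 <= t -> t <= 1 ->
  psi (x + t *: (z - x)) <= psi x + t * (psi z - psi x).

Lemma segment_convex_affine (c : R) u v :
  segment_convex (fun z => c + dot u (z - v)).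
Proof.
move=> x z t _ _; rewrite !dotE le_eqVlt; apply/orP; left; apply/eqP; ring.
Qed.

Lemma segment_convex_max h psi : segment_convex h -> segment_convex psi ->
  segment_convex (fun z => Num.max (h z) (psi z)).
Proof.
move=> hh hpsi x z t t0 t1; rewrite ge_max.
have bound (p a b c d : R) : p <= a + t * (b - a) -> a <= c -> b <= d ->
    p <= c + t * (d - c) by nra.
by apply/andP; split; [apply: bound (hh x z t t0 t1) _ _ |
  apply: bound (hpsi x z t t0 t1) _ _]; rewrite /= le_max lexx ?orbT.
Qed.

Lemma convex_set_segment X x z (t : R) : convex_set X -> X x -> X z ->
  0 <= t -> t <= 1 -> X (x + t *: (z - x)).
Proof.
move=> cX Xx Xz t0 t1.
have := cX z x (Itv01 t0 t1); rewrite !inE => /(_ Xz Xx).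
by congr (X _); rewrite /conv /= scalerBr scalerBl scale1r addrCA.
Qed.

Lemma convex_function_segment X f x z (t : R) : convex_function X f ->
  X x -> X z -> 0 <= t -> t <= 1 ->
  f (x + t *: (z - x)) <= f x + t * (f z - f x).
Proof.
move=> cf Xx Xz t0 t1.
have := cf (Itv01 t0 t1) z x; rewrite !inE convRE /= => /(_ Xz Xx) /le_trans.
have -> : x + t *: (z - x) = conv (Itv01 t0 t1) (z : convex_lmodType 'rV[R]_n) x.
  by rewrite /conv /= scalerBr scalerBl scale1r addrCA.
by apply; rewrite mulrBl mul1r mulrBr addrCA.
Qed.

(** The first-order condition: a quadratic in [t] without constant term that is
    nonnegative near [0] on the right has a nonnegative slope there. *)
Lemma ge0_of_first_order (a b : R) :
  (forall t, 0 < t -> t <= 1 -> 0 <= t * (a + t * b)) -> 0 <= a.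
Proof.
move=> ab; have [//|a_lt0] := leP 0 a; have [b_le0|b_gt0] := leP b 0.
  by have := ab 1 ltr01 (lexx _); lra.
(* At this parameter [a + t b] equals [t a], which is negative. *)
pose t := - a / (b - a).
have ba : 0 < b - a by lra.
have t0 : 0 < t by rewrite divr_gt0// oppr_gt0.
have t1 : t <= 1 by rewrite ler_pdivrMr//; lra.
have := ab t t0 t1; rewrite pmulr_rge0//.
have : t * (b - a) = - a by rewrite divfK// gt_eqF.
nra.
Qed.

Lemma min_value_argmin X f x : argmin X f x -> min_value X f = f x.
Proof.
move=> [Xx xmin]; apply/eqP; rewrite eq_le; apply/andP; split.
  apply: ge_inf; last by exists x.
  by exists (f x) => _ [z Xz <-]; exact: xmin.
by apply: lb_le_inf; [exists (f x), x | move=> _ [z Xz <-]; exact: xmin].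
Qed.

(** The supremum defining the growth modulus is attained, because for each fixed
    [x] the growth inequality is a closed condition on the constant. *)
Lemma growth_modulus_growth X f (mu : R) :
  growth_modulus X f = mu%:E -> argmin X f !=set0 -> quadratic_growth X f mu.
Proof.
move=> muE [xs xsmin] x Xx.
set D := edist_set _ _ ^+ 2.
have D_ge0 : 0 <= D by exact: sqr_ge0.
have gap_ge0 : 0 <= f x - min_value X f.
  by rewrite (min_value_argmin xsmin) subr_ge0; case: xsmin => _; exact.
have [D_le0|D_gt0] := leP D 0.
  by have -> : D = 0 by [lra]; rewrite mulr0.
have : (growth_modulus X f <= (2 * (f x - min_value X f) / D)%:E)%E.
  apply: ge_ereal_sup => _ [nu [_ nugrowth] <-].
  rewrite lee_fin ler_pdivlMr //; have := nugrowth _ Xx; rewrite -/D; lra.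
rewrite muE lee_fin ler_pdivlMr //; lra.
Qed.

End ConvexFunctions.

(** * One step of the method *)

(* The prox center of a bundle state, not the center of a ball. *)
Local Notation center := Defs.center.

Section BundleStep.
Variables (R : realType) (n : nat).
Variables (X : set 'rV[R]_n) (f : 'rV[R]_n -> R) (g : 'rV[R]_n -> 'rV[R]_n).
Variables (rho beta : R) (B : nat).
Hypotheses (convX : convex_set X) (oracle : subgradient_oracle X f g).
Hypothesis rho_gt0 : 0 < rho.

Implicit Types (s : bundle_state R n) (x y z u : 'rV[R]_n).

Definition lower_model s :=
  segment_convex (model s) /\ forall z, X z -> model s z <= f z.

Definition prox_gap s y : R :=
  f (center s) - (model s y + rho / 2 * enorm (y - center s) ^+ 2).

(** This is the optimality condition of the prox subproblem:
    [rho (center - y)] is a subgradient of the model relative to [X] at the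
    trial point. Compare the prox objective at [y] with its value on the
    segment from [y] to [z]. *)
Lemma aggregate_le_model s y z : lower_model s -> prox_trial X rho s y ->
  X z -> aggregate rho s y z <= model s z.
Proof.
move=> [cvx_m _] [Xy ymin] Xz; rewrite -subr_ge0.
apply: (@ge0_of_first_order _ _ (rho / 2 * enorm (z - y) ^+ 2)) => t t0 t1.
have := ymin _ (convex_set_segment convX Xy Xz (ltW t0) t1).
rewrite sqr_enorm_segment /aggregate.
have := cvx_m y z t (ltW t0) t1.
set w := y + _; nra.
Qed.

(** Completing the square: the aggregate plane has the same prox minimizer and
    the same prox value as the model, and it shows the quadratic growth of the
    prox objective around [y]. *)
Lemma aggregate_prox s y z :
  aggregate rho s y z + rho / 2 * enorm (z - center s) ^+ 2 =
  f (center s) - prox_gap s y + rho / 2 * enorm (z - y) ^+ 2.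
Proof.
by rewrite (sqr_enorm_sub (center s) y z) /aggregate /prox_gap; field.
Qed.

Lemma cutting_plane_le u z : X u -> X z -> cutting_plane f g u z <= f z.
Proof. by move=> Xu; exact: oracle. Qed.

Lemma lmpbm_step_center s y :
  center (lmpbm_step f g rho beta B s y) =
  if serious f beta s y then y else center s.
Proof. by rewrite /lmpbm_step; case: ifP => _; case: ifP. Qed.

Lemma lmpbm_step_cut s y z :
  cutting_plane f g y z <= model (lmpbm_step f g rho beta B s y) z.
Proof.
by rewrite /lmpbm_step; case: (_ || _); rewrite /= !le_max lexx !orbT.
Qed.

Lemma lmpbm_step_aggregate s y z :
  lower_model s -> prox_trial X rho s y -> X z ->
  aggregate rho s y z <= model (lmpbm_step f g rho beta B s y) z.
Proof.
move=> ms py Xz; rewrite /lmpbm_step; case: (_ || _); rewrite /= !le_max ?lexx//.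
by rewrite (aggregate_le_model ms py Xz).
Qed.

Lemma lmpbm_step_model s y z : ~~ serious f beta s y -> counter s <> B ->
  model s z <= model (lmpbm_step f g rho beta B s y) z.
Proof.
move=> /negbTE null /eqP/negbTE noB.
by rewrite /lmpbm_step null noB /= le_max lexx.
Qed.

Lemma lmpbm_step_lower s y : X (center s) ->
  lower_model s -> prox_trial X rho s y ->
  lower_model (lmpbm_step f g rho beta B s y).
Proof.
move=> Xc ms py; have Xy : X y by case: py.
have Xc' : X (if serious f beta s y then y else center s) by case: ifP.
have cvx_cut u : segment_convex (cutting_plane f g u) :=
  segment_convex_affine (f u) (g u) u.
have cvx_agg : segment_convex (aggregate rho s y).
  have := segment_convex_affine (model s y) (rho *: (center s - y)) y.
  by congr segment_convex; apply/funext => z; rewrite dotZl.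
split.
  rewrite /lmpbm_step; case: (_ || _) => /=.
    by do 2?apply: segment_convex_max => //.
  by apply: segment_convex_max => //; case: ms.
move=> z Xz; have mz : model s z <= f z by exact: ms.2.
rewrite /lmpbm_step; case: (_ || _); rewrite /= !ge_max !cutting_plane_le//.
  by rewrite (le_trans (aggregate_le_model ms py Xz)).
by rewrite mz.
Qed.

(** The information kept by any later model with the same center is that it lies
    above the aggregate plane; the distance between the two trial points is
    then paid for by the prox gap. This covers both compression and plain
    enrichment of the bundle. *)
Lemma prox_gap_decrease s y s' y' : center s' = center s ->
  aggregate rho s y y' <= model s' y' ->
  prox_gap s' y' + rho / 2 * enorm (y' - y) ^+ 2 <= prox_gap s y.
Proof.
move=> cs ay; have := aggregate_prox s y y'.
rewrite [prox_gap s' y']/prox_gap cs; lra.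
Qed.

(** The aggregate plane at the center lies below [f], which bounds
    [rho |y - center|^2] by [f center - model y]. *)
Lemma prox_displacement_le_gap s y : X (center s) -> lower_model s ->
  prox_trial X rho s y ->
  rho / 2 * enorm (y - center s) ^+ 2 <= prox_gap s y.
Proof.
move=> Xc ms py; have := aggregate_le_model ms py Xc.
have := ms.2 _ Xc; rewrite /aggregate /prox_gap -sqr_enorm.
rewrite sqr_enorm_subC; lra.
Qed.

(** The aggregate plane plus a prox term centered at [y] is at least
    [model y - rho/2 |y - center|^2]. So the new gap is at most
    [(f y - model y) + rho/2 |y - center|^2]: the serious test bounds the first
    summand by [1 - beta] times the predicted decrease, which is at most twice
    the gap, and [prox_displacement_le_gap] bounds the second by the gap. *)
Lemma prox_gap_serious s y s' y' : beta <= 1 ->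
  X (center s) -> lower_model s -> prox_trial X rho s y ->
  serious f beta s y -> center s' = y ->
  aggregate rho s y y' <= model s' y' ->
  prox_gap s' y' <= (3 - 2 * beta) * prox_gap s y.
Proof.
move=> beta1 Xc ms py; rewrite /serious => ser cs ay.
have := prox_displacement_le_gap Xc ms py.
have : model s y - rho / 2 * enorm (y - center s) ^+ 2 <=
    aggregate rho s y y' + rho / 2 * enorm (y' - y) ^+ 2.
  have := mulr_ge0 (ltW rho_gt0) (sqr_ge0 (enorm (y' - y - (y - center s)))).
  rewrite /aggregate -opprB !sqr_enorm !dotE !(dotC y' y) !(dotC (center s)).
  lra.
rewrite /prox_gap cs.
set D := rho / 2 * _; set D' := rho / 2 * _.
move: ser ay; nra.
Qed.

(** The linearization plus the prox term is minimized over the whole space at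
    [x - rho^-1 g x], where the gap would be the right-hand side. *)
Lemma prox_gap_init x y :
  prox_gap (BundleState x (cutting_plane f g x) 0) y <=
    enorm (g x) ^+ 2 / (2 * rho).
Proof.
rewrite /prox_gap /= /cutting_plane.
have : 0 <= enorm (g x + rho *: (y - x)) ^+ 2 by exact: sqr_ge0.
rewrite ler_pdivlMr ?mulr_gt0//.
rewrite !sqr_enorm !dotE !(dotC (g x)) !(dotC x y). nra.
Qed.

Section Growth.
Variables (mu : R).
Hypotheses (mu_gt0 : 0 < mu) (convf : convex_function X f).
Hypotheses (fmin : argmin X f !=set0) (growth : quadratic_growth X f mu).

Let M := Num.max 2 (4 * rho / mu).

(** The points at parameter [t] of the segment from the center to a minimizer
    give [gap >= (t - rho t^2 / mu) * obj]. The best parameter is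
    [mu / (2 rho)] when it lies in [[0, 1]], and otherwise [1] is enough. *)
Lemma prox_gap_lower s y : X (center s) -> lower_model s ->
  prox_trial X rho s y ->
  f (center s) - min_value X f <= M * prox_gap s y.
Proof.
move=> Xc ms [Xy ymin]; set G := f _ - _.
have G_ge0 : 0 <= G.
  have [xs xsmin] := fmin; rewrite /G (min_value_argmin xsmin) subr_ge0.
  by case: xsmin => _; exact.
have key t : 0 < t -> t <= 1 -> t * G - rho * t ^+ 2 / mu * G <= prox_gap s y.
  move=> t0 t1.
  have rt : 0 < rho / 2 * t ^+ 2 by rewrite mulr_gt0 ?divr_gt0 ?exprn_gt0.
  have le_dist : (t * G - prox_gap s y) / (rho / 2 * t ^+ 2) <=
      edist_set (center s) (argmin X f) ^+ 2.
    apply: le_sqr_edist_set => // a amin; have [Xa _] := amin.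
    rewrite ler_pdivrMr//.
    have Xw := convex_set_segment convX Xc Xa (ltW t0) t1.
    have := convex_function_segment convf Xc Xa (ltW t0) t1.
    have := ymin _ Xw; have := ms.2 _ Xw.
    rewrite [_ + _ *: _ - _]addrAC subrr add0r sqr_enormZ (sqr_enorm_subC a).
    rewrite /prox_gap /G (min_value_argmin amin).
    set w := center s + _; lra.
  have := growth Xc; rewrite -/G => gr.
  have : mu / 2 * ((t * G - prox_gap s y) / (rho / 2 * t ^+ 2)) <= G.
    by apply: le_trans gr; rewrite ler_pM2l ?divr_gt0.
  rewrite mulrA ler_pdivrMr// => h.
  rewrite lerBlDl -lerBlDr.
  rewrite mulrAC ler_pdivlMr//; lra.
have [M_le|M_gt] := leP 2 (4 * rho / mu); rewrite /M.
- rewrite max_r//.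
  have /key : 0 < mu / (2 * rho) by rewrite divr_gt0// mulr_gt0.
  have -> : mu / (2 * rho) * G - rho * (mu / (2 * rho)) ^+ 2 / mu * G =
      G / (4 * rho / mu) by field; rewrite !gt_eqF.
  rewrite ler_pdivrMr ?mulr_gt0// mul1r ler_pdivrMr ?divr_gt0 ?mulr_gt0//.
  rewrite [_ * prox_gap _ _]mulrC; apply.
  by move: M_le; rewrite ler_pdivlMr//; lra.
- rewrite (max_l (ltW M_gt)); have := key 1 ltr01 (lexx _).
  have : rho / mu <= 1 / 2.
    by move: M_gt; rewrite ltr_pdivrMr// ler_pdivrMr//; lra.
  rewrite expr1n mulr1 mul1r; nra.
Qed.

(** A serious step realizes the fraction [beta] of the predicted decrease, which
    is at least the prox gap. *)
Lemma serious_decrease s y : 0 <= beta -> X (center s) -> lower_model s ->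
  prox_trial X rho s y -> serious f beta s y ->
  f y - min_value X f <= gamma_rate beta mu rho * (f (center s) - min_value X f).
Proof.
move=> beta0 Xc ms py ser; have := prox_gap_lower Xc ms py.
move: ser; rewrite /serious /gamma_rate -/M.
have M_gt0 : 0 < M by rewrite lt_max ltr0n.
set G := f (center s) - min_value X f.
rewrite [M * _]mulrC -ler_pdivrMr//.
have : 0 <= rho / 2 * enorm (y - center s) ^+ 2 by rewrite mulr_ge0 ?sqr_ge0 ?divr_ge0 ?ltW.
have -> : (1 - beta / M) * G = G - beta * (G / M) by ring.
rewrite /prox_gap; set D := rho / 2 * _; set q := G / M.
move=> D_ge0 ser q_le; have : beta * q <= beta * (f (center s) - model s y).
  by rewrite ler_wpM2l//; lra.
rewrite /G; lra.
Qed.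

End Growth.
End BundleStep.

(** * Runs and streaks of null steps *)

Section Run.
Variables (R : realType) (n : nat).
Variables (X : set 'rV[R]_n) (f : 'rV[R]_n -> R) (g : 'rV[R]_n -> 'rV[R]_n).
Variables (rho beta : R) (B : nat) (x0 : 'rV[R]_n).
Variables (s : nat -> bundle_state R n) (y : nat -> 'rV[R]_n).
Hypotheses (convX : convex_set X) (oracle : subgradient_oracle X f g).
Hypotheses (rho_gt0 : 0 < rho) (beta_ge0 : 0 <= beta) (beta_lt1 : beta < 1).
Hypotheses (Xx0 : X x0) (run : lmpbm_run X f g rho beta B x0 s y).

Let gap t := prox_gap f rho (s t) (y t).
Let is_serious t := serious f beta (s t) (y t).

Let prox t : prox_trial X rho (s t) (y t). Proof. exact: (run.2 t).1. Qed.
Let stepE t : s t.+1 = lmpbm_step f g rho beta B (s t) (y t).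
Proof. exact: (run.2 t).2. Qed.

Lemma run_invariant t : X (center (s t)) /\ lower_model X f (s t).
Proof.
elim: t => [|t [Xc ms]].
  rewrite run.1 /=; split => //; split => [|z Xz].
    exact: (segment_convex_affine (f x0) (g x0) x0).
  exact: (cutting_plane_le oracle Xx0 Xz).
rewrite stepE; split; last first.
  exact: (lmpbm_step_lower _ _ convX oracle Xc ms (prox t)).
by rewrite lmpbm_step_center; case: ifP => _ //; case: (prox t).
Qed.

Lemma center_null t : ~~ is_serious t -> center (s t.+1) = center (s t).
Proof. by move=> /negbTE null; rewrite stepE lmpbm_step_center -/(is_serious t) null. Qed.

Lemma center_serious t : is_serious t -> center (s t.+1) = y t.
Proof. by move=> ser; rewrite stepE lmpbm_step_center -/(is_serious t) ser. Qed.

Lemma counter_reset t : is_serious t || (counter (s t) == B) ->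
  counter (s t.+1) = 0%N.
Proof. by rewrite stepE /lmpbm_step => ->. Qed.

(** Both update rules leave the next model above the aggregate plane. *)
Lemma next_aggregate t :
  aggregate rho (s t) (y t) (y t.+1) <= model (s t.+1) (y t.+1).
Proof.
have [_ ms] := run_invariant t; have [Xy _] := prox t.+1.
by rewrite stepE; exact: (lmpbm_step_aggregate _ _ _ convX ms (prox t) Xy).
Qed.

Lemma gap_null t : ~~ is_serious t -> gap t.+1 <= gap t.
Proof.
move=> null.
apply: le_trans (prox_gap_decrease f (center_null null) (next_aggregate t)).
by rewrite lerDl mulr_ge0 ?sqr_ge0 ?divr_ge0 ?ltW.
Qed.

Lemma gap_serious t : is_serious t -> gap t.+1 <= (3 - 2 * beta) * gap t.
Proof.
move=> ser; have [Xc ms] := run_invariant t.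
exact: (prox_gap_serious convX rho_gt0 (ltW beta_lt1) Xc ms (prox t) ser
  (center_serious ser) (next_aggregate t)).
Qed.

(** Before the compression at the end of the bundle, null steps only add cuts to
    the model. *)
Lemma null_streak tau r : counter (s tau) = 0%N -> (r <= B)%N ->
  (forall i, (i < r)%N -> ~~ is_serious (tau + i)) ->
  [/\ center (s (tau + r)) = center (s tau), counter (s (tau + r)) = r,
      forall i z, (i <= r)%N -> model (s (tau + i)) z <= model (s (tau + r)) z &
      forall i z, (i < r)%N ->
        cutting_plane f g (y (tau + i)) z <= model (s (tau + r)) z].
Proof.
move=> c0; elim: r => [_ _|r IHr rB nulls].
  by rewrite addn0; split => // i z; rewrite leqn0 => /eqP ->; rewrite addn0.
have [||ctr cnt mono cuts] := IHr; first exact: ltnW.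
  by move=> i ir; apply: nulls; rewrite ltnW.
have null : ~~ is_serious (tau + r) by exact: nulls.
have cntB : counter (s (tau + r)) <> B by rewrite cnt => rE; rewrite rE ltnn in rB.
have up z : model (s (tau + r)) z <= model (s (tau + r).+1) z.
  by rewrite stepE; exact: lmpbm_step_model.
rewrite addnS; split; first by rewrite center_null.
- rewrite stepE /lmpbm_step -/(is_serious _) (negbTE null) /=.
  by move/eqP/negbTE: cntB => ->; rewrite /= cnt.
- move=> i z; rewrite leq_eqVlt ltnS => /orP[/eqP ->|ir]; first by rewrite addnS.
  exact: le_trans (mono i z ir) (up z).
- move=> i z; rewrite ltnS leq_eqVlt => /orP[/eqP ->|ir].
    by rewrite stepE; exact: lmpbm_step_cut.
  exact: le_trans (cuts i z ir) (up z).
Qed.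

Lemma gap_streak tau r i j : counter (s tau) = 0%N -> (r <= B)%N ->
  (forall i, (i < r)%N -> ~~ is_serious (tau + i)) ->
  (i <= j)%N -> (j <= r)%N ->
  gap (tau + j) + rho / 2 * enorm (y (tau + j) - y (tau + i)) ^+ 2 <=
    gap (tau + i).
Proof.
move=> c0 rB nulls ij jr.
have nulls' q : (q <= r)%N -> forall i, (i < q)%N -> ~~ is_serious (tau + i).
  by move=> qr i' i'q; apply: nulls; exact: leq_trans qr.
have [cj _ mono _] := null_streak c0 (leq_trans jr rB) (nulls' _ jr).
have ir := leq_trans ij jr.
have [ci _ _ _] := null_streak c0 (leq_trans ir rB) (nulls' _ ir).
have [_ ms] := run_invariant (tau + i).
have Xy : X (y (tau + j)) by case: (prox (tau + j)).
apply: prox_gap_decrease; first by rewrite cj ci.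
exact: le_trans (aggregate_le_model convX ms (prox _) Xy) (mono _ _ ij).
Qed.

Section Pieces.
Variables (k : nat) (L : R) (P : 'I_k -> set 'rV[R]_n).
Hypotheses (L_gt0 : 0 < L) (cover : X `<=` \bigcup_i P i).
Hypotheses (pieces : piecewise_oracle_bound f g L P) (kB : (k <= B)%N).

(** The pigeonhole step. Since [k <= B], two of the [B + 1] trial points share a
    piece, on which the cut at the earlier one approximates [f] quadratically
    at the later one; the null test there says that the model is far from
    [f]. *)
Lemma gap_full_null_streak tau : counter (s tau) = 0%N ->
  (forall i, (i <= B)%N -> ~~ is_serious (tau + i)) ->
  gap (tau + B).+1 <= theta_rate beta L rho * gap tau.
Proof.
move=> c0 nulls.
have nulls' q : (q <= B)%N -> forall i, (i < q)%N -> ~~ is_serious (tau + i).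
  by move=> qB i iq; apply: nulls; rewrite ltnW// (leq_trans iq).
have /choice[h hP] : forall r : 'I_B.+1, exists i, P i (y (tau + r)).
  move=> r; have : X (y (tau + r)) by case: (prox (tau + r)).
  by move=> /cover[i _ Pi]; exists i.
(* [h] assigns a piece to each trial point of the streak. *)
have : ~~ injectiveb h.
  apply/negP => /injectiveP/leq_card; rewrite !card_ord => Bk.
  by have := leq_trans Bk kB; rewrite ltnn.
move=> /injectivePn[i0 [j0 ij0 hij0]].
have [i [j [ij jB Piy Pjy]]] : exists i j : nat, [/\ (i < j)%N, (j <= B)%N,
    P (h i0) (y (tau + i)) & P (h i0) (y (tau + j))].
  have [lt_ij|lt_ji|/val_inj eq_ij] := ltngtP i0 j0.
  - exists i0, j0; split=> //; first exact: (ltn_ord j0).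
    by rewrite hij0.
  - exists j0, i0; split=> //; first exact: (ltn_ord i0).
    by rewrite hij0.
  - by rewrite eq_ij eqxx in ij0.
have [_ _ _ cuts] := null_streak c0 jB (nulls' _ jB).
have := gap_streak c0 (leqnn B) (nulls' _ (leqnn B)) (leq0n i) (leq_trans (ltnW ij) jB).
have := gap_streak c0 (leqnn B) (nulls' _ (leqnn B)) (ltnW ij) jB.
have := gap_streak c0 (leqnn B) (nulls' _ (leqnn B)) jB (leqnn B).
have := gap_null (nulls B (leqnn B)).
have := pieces Pjy Piy; have := cuts i (y (tau + j)) ij.
have := nulls j jB.
rewrite addn0 /is_serious /serious -ltNge.
have : gap (tau + j) <= f (center (s (tau + j))) - model (s (tau + j)) (y (tau + j)).
  rewrite /gap /prox_gap.
  have := mulr_ge0 (ltW rho_gt0) (sqr_ge0 (enorm (y (tau + j) - center (s (tau + j))))).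
  lra.
have sq a b : 0 <= rho / 2 * enorm (y a - y b) ^+ 2.
  by rewrite mulr_ge0 ?sqr_ge0 ?divr_ge0 ?ltW.
have := sq (tau + B)%N (tau + j)%N; have := sq (tau + i)%N tau.
set D := enorm (y (tau + j) - y (tau + i)) ^+ 2.
set S := rho / 2 * D.
set F := f (center _); set m := model _ _; set c := cutting_plane _ _ _ _.
move=> dist_i0 dist_Bj gap_j null_j cut_le err_le drop_last drop_jB drop_ij drop_0i.
have le_tj : gap (tau + B).+1 <= gap (tau + j) by lra.
have le_i0 : gap (tau + i) <= gap tau by lra.
have key : (1 - beta) * gap (tau + j) <= L / 2 * D.
  apply: (@le_trans _ _ ((1 - beta) * (F - m))); last by lra.
  by rewrite ler_wpM2l// subr_ge0 ltW.
have : rho * ((1 - beta) * gap (tau + j)) <= L * (gap tau - gap (tau + j)).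
  apply: (@le_trans _ _ (rho * (L / 2 * D))); first by rewrite ler_pM2l.
  have -> : rho * (L / 2 * D) = L * S by rewrite /S; ring.
  rewrite ler_pM2l//; lra.
move=> weighted_drop.
have den_gt0 : 0 < L + (1 - beta) * rho by rewrite addr_gt0 ?mulr_gt0 ?subr_gt0.
apply: le_trans le_tj _; rewrite /theta_rate [leRHS]mulrAC ler_pdivlMr//.
lra.
Qed.

Variables (mu : R).
Hypotheses (mu_gt0 : 0 < mu) (convf : convex_function X f).
Hypotheses (fmin : argmin X f !=set0) (growth : quadratic_growth X f mu).

Let obj t := f (center (s t)) - min_value X f.

(** A block starts with counter [0] and stops at its first serious step, or at
    the compression ending [B + 1] null steps; in both cases the counter is
    [0] again. *)
Lemma block_progress tau : counter (s tau) = 0%N ->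
  exists tau', [/\ (tau' <= tau + B.+1)%N, counter (s tau') = 0%N &
    (gap tau' <= theta_rate beta L rho * gap tau /\ obj tau' = obj tau) \/
    (gap tau' <= (3 - 2 * beta) * gap tau /\
       obj tau' <= gamma_rate beta mu rho * obj tau)].
Proof.
move=> c0.
have [/existsP[r0 ser0]|] := boolP [exists r : 'I_B.+1, is_serious (tau + r)].
  have ex : exists r, is_serious (tau + r) by exists r0.
  case: (ex_minnP ex) => r ser rmin.
  have rB : (r <= B)%N by rewrite (leq_trans (rmin _ ser0))// -ltnS.
  have nulls i : (i < r)%N -> ~~ is_serious (tau + i).
    by move=> ir; apply/negP => /rmin; rewrite leqNgt ir.
  exists (tau + r).+1; split.
  - by rewrite -addnS leq_add2l ltnS.
  - by apply: counter_reset; rewrite ser.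
  - have [cr _ _ _] := null_streak c0 rB nulls.
    have [Xc ms] := run_invariant (tau + r).
    right; split.
      apply: le_trans (gap_serious ser) _; rewrite ler_wpM2l//.
        by move: beta_lt1; lra.
      have := gap_streak c0 rB nulls (leq0n r) (leqnn r); rewrite addn0.
      apply: le_trans; rewrite lerDl.
      by rewrite mulr_ge0 ?sqr_ge0 ?divr_ge0 ?ltW.
    rewrite /obj center_serious// -cr.
    exact: (serious_decrease convX rho_gt0 mu_gt0 convf fmin growth beta_ge0 Xc ms).
move=> /existsPn noser.
have nulls i : (i <= B)%N -> ~~ is_serious (tau + i).
  by move=> iB; exact: (noser (Ordinal (iB : (i < B.+1)%N))).
have nulls' i : (i < B)%N -> ~~ is_serious (tau + i) by move=> /ltnW; exact: nulls.
have [cB cntB _ _] := null_streak c0 (leqnn B) nulls'.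
exists (tau + B).+1; split; first by rewrite addnS.
- by apply: counter_reset; rewrite cntB eqxx orbT.
- left; split; first exact: gap_full_null_streak.
  by rewrite /obj center_null ?nulls// cB.
Qed.

End Pieces.
End Run.

(** * The potential *)

Section Potential.
Variable R : realType.
Implicit Types (a b c d e o m M L rho mu theta : R).

Lemma ln_le_subr1 a : 0 < a -> ln a <= a - 1.
Proof. by move=> a0; have := @le_ln1Dx R (a - 1); rewrite addrCA subrr addr0; apply; lra. Qed.

(** The form [ln (c b) <= ln b + (c - 1)] avoids logarithms of the rates. *)
Lemma ln_le_scale a b c : 0 < a -> 0 < b -> 0 < c -> a <= c * b ->
  ln a <= ln b + (c - 1).
Proof.
move=> a0 b0 c0 acb; apply: (@le_trans _ _ (ln (c * b))).
  by rewrite ler_ln ?posrE ?mulr_gt0.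
by rewrite lnM ?posrE// addrC lerD2l ln_le_subr1.
Qed.

(** The weight [4 M] makes the term [ln o] lose [2] at a serious step, which covers
    both the increase [2 - 1 = 1] allowed to [ln d] and the announced drop
    [1 - theta <= 1]. *)
Lemma potential_drop M theta d d' o o' : 2 <= M -> 0 < theta ->
  0 < d -> 0 < d' -> 0 < o -> 0 < o' ->
  (d' <= theta * d /\ o' = o) \/ (d' <= 2 * d /\ o' <= (1 - 1 / 2 / M) * o) ->
  ln d' + 4 * M * ln o' + (1 - theta) <= ln d + 4 * M * ln o.
Proof.
move=> M2 th0 d0 d'0 o0 o'0 [[dd ->]|[dd oo]].
  by have := ln_le_scale d'0 d0 th0 dd; lra.
have M0 : 0 < M by lra.
have rate_gt0 : 0 < 1 - 1 / 2 / M.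
  by rewrite subr_gt0 ltr_pdivrMr//; lra.
have := ln_le_scale d'0 d0 (ltr0n R 2) dd.
have : 4 * M * ln o' <= 4 * M * (ln o + (1 - 1 / 2 / M - 1)).
  rewrite ler_pM2l ?mulr_gt0//; exact: ln_le_scale.
have -> : 4 * M * (ln o + (1 - 1 / 2 / M - 1)) = 4 * M * ln o - 2.
  by field; rewrite gt_eqF.
lra.
Qed.

(** The product expands to [1 + rho/mu + L/rho + L/mu] up to a constant. When
    [rho] lies between [mu] and [L], each middle term is at most [1] or at most
    [L/mu]. *)
Lemma mixed_ratio_le L rho mu : 0 < L -> 0 < mu -> 0 < rho ->
  Num.min mu L <= rho -> rho <= Num.max mu L ->
  Num.max 2 (4 * rho / mu) * (1 + L / rho) <= 12 * (1 + L / mu).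
Proof.
move=> L0 mu0 rho0.
have M4 : Num.max 2 (4 * rho / mu) <= 4 * (1 + rho / mu).
  have := divr_gt0 rho0 mu0; rewrite ge_max -mulrA => q0; apply/andP; split; lra.
have Lr0 : 0 < L / rho by rewrite divr_gt0.
move=> lo hi.
apply: (@le_trans _ _ (4 * (1 + rho / mu) * (1 + L / rho))).
  by rewrite ler_pM2r//; lra.
have -> : 4 * (1 + rho / mu) * (1 + L / rho) =
    4 * (1 + rho / mu + L / rho + L / mu) by field; rewrite !gt_eqF.
suff : rho / mu + L / rho <= 2 * (1 + L / mu).
  have : 0 < L / mu by rewrite divr_gt0.
  lra.
have [muL|Lmu] := leP mu L.
  move: lo hi; rewrite (min_l muL) (max_r muL) => lo hi.
  have : rho / mu <= L / mu by rewrite ler_pM2r ?invr_gt0.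
  have : L / rho <= L / mu by rewrite ler_pM2l// lef_pV2.
  lra.
move: lo hi; rewrite (min_r (ltW Lmu)) (max_l (ltW Lmu)) => lo hi.
have : rho / mu <= 1 by rewrite ler_pdivrMr// mul1r.
have : L / rho <= 1 by rewrite ler_pdivrMr// mul1r.
have : 0 < L / mu by rewrite divr_gt0.
lra.
Qed.

End Potential.

(** * Complexity *)

Section Complexity.
Variables (R : realType) (n : nat).
Variables (X : set 'rV[R]_n) (f : 'rV[R]_n -> R) (g : 'rV[R]_n -> 'rV[R]_n).
Variables (rho : R) (B : nat) (x0 : 'rV[R]_n).
Variables (s : nat -> bundle_state R n) (y : nat -> 'rV[R]_n).
Variables (k : nat) (L : R) (P : 'I_k -> set 'rV[R]_n) (mu eps : R).
Hypotheses (convX : convex_set X) (oracle : subgradient_oracle X f g).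
Hypotheses (rho_gt0 : 0 < rho) (Xx0 : X x0).
Hypotheses (run : lmpbm_run X f g rho (1 / 2) B x0 s y).
Hypotheses (L_gt0 : 0 < L) (cover : X `<=` \bigcup_i P i).
Hypotheses (pieces : piecewise_oracle_bound f g L P) (kB : (k <= B)%N).
Hypotheses (mu_gt0 : 0 < mu) (convf : convex_function X f).
Hypotheses (fmin : argmin X f !=set0) (growth : quadratic_growth X f mu).
Hypotheses (eps_gt0 : 0 < eps) (eps_lt : eps < f x0 - min_value X f).

Let gap t := prox_gap f rho (s t) (y t).
Let obj t := f (center (s t)) - min_value X f.
Let M := Num.max 2 (4 * rho / mu).
Let theta := theta_rate (1 / 2) L rho.
Let potential t := ln (gap t) + 4 * M * ln (obj t).
Let l1 := ln ((f x0 - min_value X f) / eps).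
Let l2 := ln (2 * enorm (g x0) ^+ 2 / (Num.min rho mu * eps)).

Let M_gt0 : 0 < M. Proof. by rewrite lt_max ltr0n. Qed.
Let beta_ge0 : 0 <= 1 / 2 :> R. Proof. lra. Qed.
Let beta_lt1 : 1 / 2 < 1 :> R. Proof. lra. Qed.

Lemma obj_le_gap t : obj t <= M * gap t.
Proof.
have [Xc ms] := run_invariant convX oracle Xx0 run t.
have [prox _] := run.2 t.
exact: (prox_gap_lower convX rho_gt0 mu_gt0 convf fmin growth Xc ms prox).
Qed.

(** The factor [M / (2 rho)] is the maximum of [1 / rho] and [2 / mu], hence at
    most [2 / min (rho, mu)]. *)
Lemma gap0_le : M * gap 0%N <= 2 * enorm (g x0) ^+ 2 / Num.min rho mu.
Proof.
apply: (@le_trans _ _ (M * (enorm (g x0) ^+ 2 / (2 * rho)))).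
  by rewrite ler_pM2l// /gap run.1; exact: prox_gap_init.
have g_ge0 : 0 <= enorm (g x0) ^+ 2 by exact: sqr_ge0.
have min_gt0 : 0 < Num.min rho mu by rewrite lt_min rho_gt0.
rewrite mulrCA [leRHS]mulrAC [leRHS]mulrC ler_wpM2l//.
rewrite ler_pdivlMr// mulrC mulrA ler_pdivrMr ?mulr_gt0//.
rewrite /M; have [h|h] := leP 2 (4 * rho / mu).
  have -> : Num.min rho mu * (4 * rho / mu) = 4 * rho * (Num.min rho mu / mu).
    by field; rewrite gt_eqF.
  have : Num.min rho mu / mu <= 1 by rewrite ler_pdivrMr// mul1r ge_min lexx orbT.
  by rewrite -(ler_pM2l rho_gt0); lra.
have : Num.min rho mu <= rho by rewrite ge_min lexx.
lra.
Qed.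

(** Chains [m] blocks. They are counted only while the target accuracy is missed,
    which keeps the arguments of the logarithms positive. *)
Lemma exists_block_end m T : (m * B.+1 <= T)%N ->
  (forall t, (t <= T)%N -> eps < obj t) ->
  exists t, [/\ (t <= m * B.+1)%N, counter (s t) = 0%N &
    potential t + m%:R * (1 - theta) <= potential 0%N].
Proof.
have th_gt0 : 0 < theta.
  by rewrite /theta /theta_rate divr_gt0// addr_gt0// mulr_gt0//; lra.
have M2 : 2 <= M by rewrite le_max lexx.
move=> mT far.
have far_gt0 t : (t <= T)%N -> 0 < obj t /\ 0 < gap t.
  move=> /far lt_obj; have obj_gt0 : 0 < obj t by exact: lt_trans lt_obj.
  by split=> //; rewrite -(pmulr_rgt0 _ M_gt0) (lt_le_trans obj_gt0) ?obj_le_gap.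
elim: m mT => [_|m IHm mT].
  by exists 0%N; split; rewrite ?mul0r ?addr0// run.1.
have mT' : (m * B.+1 <= T)%N by apply: leq_trans mT; rewrite leq_mul2r leqnSn orbT.
have [t [tm c0 pot]] := IHm mT'.
have [t' [t't c0' step]] := block_progress convX oracle rho_gt0 beta_ge0 beta_lt1 Xx0
  run L_gt0 cover pieces kB mu_gt0 convf fmin growth c0.
have t'm : (t' <= m.+1 * B.+1)%N by rewrite mulSn addnC (leq_trans t't)// leq_add2r.
exists t'; split=> //.
have [opos dpos] := far_gt0 _ (leq_trans tm mT').
have [opos' dpos'] := far_gt0 _ (leq_trans t'm mT).
have rate2 : 3 - 2 * (1 / 2) = 2 :> R by lra.
rewrite rate2 in step.
have := potential_drop M2 th_gt0 dpos dpos' opos opos' step.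
have mS : m.+1%:R = m%:R + 1 :> R by rewrite natr1.
rewrite mS -/(potential t) -/(potential t'); lra.
Qed.

(** Both logarithms are bounded below as long as the objective gap exceeds [eps],
    the one of the prox gap through [obj_le_gap]. *)
Lemma potential_range t : eps < obj t ->
  potential 0%N - potential t <= l2 + 4 * M * l1.
Proof.
move=> lt_obj; have obj_gt0 : 0 < obj t by exact: lt_trans lt_obj.
have min_gt0 : 0 < Num.min rho mu by rewrite lt_min rho_gt0.
have obj0 : obj 0%N = f x0 - min_value X f by rewrite /obj run.1.
have obj0_gt0 : 0 < obj 0%N by rewrite obj0; exact: lt_trans eps_lt.
have gap_gt0 i : 0 < obj i -> 0 < gap i.
  by move=> oi; rewrite -(pmulr_rgt0 _ M_gt0) (lt_le_trans oi) ?obj_le_gap.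
have : ln (obj 0%N) - ln (obj t) <= l1.
  rewrite /l1 -obj0 ln_div ?posrE// lerD2l lerN2 ler_ln ?posrE//; exact: ltW.
rewrite -(@ler_pM2l _ (4 * M)) ?mulr_gt0// => h1.
have : ln (gap 0%N) - ln (gap t) <= l2.
  rewrite -ln_div ?posrE ?gap_gt0// /l2.
  have num : gap 0%N / gap t <= 2 * enorm (g x0) ^+ 2 / (Num.min rho mu * eps).
    rewrite ler_pdivrMr ?gap_gt0//.
    have -> : 2 * enorm (g x0) ^+ 2 / (Num.min rho mu * eps) * gap t =
        2 * enorm (g x0) ^+ 2 / Num.min rho mu * (gap t / eps).
      by rewrite invfM; ring.
    apply: (@le_trans _ _ (M * gap 0%N * (gap t / eps))); last first.
      by rewrite ler_pM2r ?divr_gt0 ?gap_gt0//; exact: gap0_le.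
    have -> : M * gap 0%N * (gap t / eps) = gap 0%N * (M * gap t / eps) by ring.
    apply: ler_peMr; first exact: ltW (gap_gt0 _ obj0_gt0).
    rewrite ler_pdivlMr// mul1r.
    exact: le_trans (ltW lt_obj) (obj_le_gap t).
  have q0 : 0 < gap 0%N / gap t by rewrite divr_gt0 ?gap_gt0.
  by rewrite ler_ln ?posrE// (lt_le_trans q0 num).
rewrite /potential; lra.
Qed.

(** The second bound is the chain
    [eps < obj 0 <= M gap 0 <= 2 |g x0|^2 / min (rho, mu)]. *)
Lemma log_terms_ge0 : 0 <= l1 /\ 0 <= l2.
Proof.
have min_gt0 : 0 < Num.min rho mu by rewrite lt_min rho_gt0.
split; apply: ln_ge0.
  by rewrite ler_pdivlMr// mul1r ltW.
rewrite ler_pdivlMr ?mulr_gt0// mul1r.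
move: gap0_le; rewrite ler_pdivlMr//; apply: le_trans.
rewrite mulrC ler_pM2r//; apply: le_trans (obj_le_gap 0%N).
by rewrite /obj run.1; exact: ltW.
Qed.

(** Since [1 - theta] is the inverse of [1 + 2 L / rho], a number of blocks above
    [(1 + 2 L / rho) (l2 + 4 M l1)] would exhaust the potential. The first
    iteration whose center is accurate enough starts after a serious step,
    because null steps keep the center. *)
Lemma lmpbm_complexity : Num.min mu L <= rho -> rho <= Num.max mu L ->
  (0 < k)%N ->
  reaches_within X f (1 / 2) x0 s y eps
    (B%:R * (3 + 192 * (1 + L / mu) * l1 + 4 * (1 + L / rho) * l2)).
Proof.
move=> lo hi k_gt0.
have [l1_ge0 l2_ge0] := log_terms_ge0.
pose K := l2 + 4 * M * l1.
have K_ge0 : 0 <= K by rewrite addr_ge0// !mulr_ge0// ltW.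
pose m := (Num.truncn ((1 + 2 * L / rho) * K)).+1.
have [mlo mhi] : m%:R <= (1 + 2 * L / rho) * K + 1 /\ (1 + 2 * L / rho) * K < m%:R.
  have bound_ge0 : 0 <= (1 + 2 * L / rho) * K.
    by rewrite mulr_ge0// addr_ge0// divr_ge0 ?mulr_ge0 ?ltW.
  have /andP[h1 h2] := truncn_itv bound_ge0.
  by split=> //; rewrite /m -natr1 lerD2r.
have [near|] := pselect (exists t, (t <= m * B.+1)%N && (obj t <= eps)).
  case: (ex_minnP near) => t /andP[tm obj_t] tmin.
  case: t => [|t] in tm obj_t tmin *.
    by move: obj_t; rewrite /obj run.1 leNgt eps_lt.
  exists t.+1; split=> //.
    exists t => //; apply: contraT => null.
    have := tmin t; rewrite ltnn (ltnW tm) /obj -(center_null run null) obj_t.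
    by move=> /(_ isT).
  rewrite [size _]/= size_map size_iota.
  have : (t.+2)%:R <= (m * B.+1).+1%:R :> R by rewrite ler_nat ltnS.
  move=> /le_trans; apply.
  have B1 : 1 <= B%:R :> R by rewrite ler1n (leq_trans k_gt0).
  rewrite -natr1 natrM -natr1.
  have mix := mixed_ratio_le L_gt0 mu_gt0 rho_gt0 lo hi.
  have m_ge0 : 0 <= m%:R :> R by rewrite ler0n.
  (* The number of calls is at most [m (B + 1) + 1 <= B (2 m + 1)] as [B >= 1], and
     [2 (1 + 2 L / rho) (l2 + 4 M l1) <= 4 (1 + L / rho) (l2 + 4 M l1)], where
     [16 M (1 + L / rho) <= 16 * 12 (1 + L / mu)]. *)
  apply: (@le_trans _ _ (B%:R * (2 * m%:R + 1))); first by nra.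
  rewrite ler_pM2l ?(lt_le_trans ltr01)//.
  have mixl : M * (1 + L / rho) * l1 <= 12 * (1 + L / mu) * l1 by rewrite ler_wpM2r.
  have Lr : 0 < L / rho by rewrite divr_gt0.
  have Ml : 0 <= M * l1 by rewrite mulr_ge0// ltW.
  move: mlo; rewrite /K; rewrite -[2 * L / rho]mulrA.
  nra.
move=> /forallNP far.
have far' t : (t <= m * B.+1)%N -> eps < obj t.
  by move=> tm; rewrite ltNge; apply/negP => le_t; apply: (far t); rewrite tm.
have [t [tm _ pot]] := exists_block_end (leqnn _) far'.
have := potential_range (far' _ tm); rewrite -/K => range.
have : m%:R * (1 - theta) <= K by apply: le_trans range; rewrite lerBrDl.
have -> : 1 - theta = (1 + 2 * L / rho)^-1.
  rewrite /theta /theta_rate; field.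
  by rewrite !gt_eqF// addr_gt0// mulr_gt0.
rewrite ler_pdivrMr; last by rewrite addr_gt0// divr_gt0 ?mulr_gt0.
by rewrite [K * _]mulrC leNgt mhi.
Qed.

End Complexity.

Theorem corollary5p1 (R : realType) :
  exists2 C : R, 0 < C &
  forall (n : nat) (X : set 'rV[R]_n) (f : 'rV[R]_n -> R)
    (g : 'rV[R]_n -> 'rV[R]_n)
    (k : nat) (L : R) (P : 'I_k -> set 'rV[R]_n) (mu : R)
    (x0 : 'rV[R]_n) (rho beta : R) (B : nat) (eps : R)
    (s : nat -> bundle_state R n) (y : nat -> 'rV[R]_n),
  X !=set0 -> closed X -> convex_set X ->
  convex_function X f -> lsc_on X f -> argmin X f !=set0 ->
  subgradient_oracle X f g ->
  (0 < k)%N -> 0 < L ->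
  piecewise_smooth X f L P -> piecewise_oracle_bound f g L P ->
  growth_modulus X f = mu%:E -> 0 < mu ->
  X x0 -> (k <= B)%N ->
  0 < eps -> eps < f x0 - min_value X f ->
  beta = 1 / 2 ->
  Num.min mu L <= rho -> rho <= Num.max mu L ->
  lmpbm_run X f g rho beta B x0 s y ->
  [/\ reaches_within X f beta x0 s y eps
        (C * (B%:R * (1 + L / mu) *
                (1 + ln ((f x0 - min_value X f) / (eps * Num.min 1 (mu / rho)))) +
              B%:R * (1 + L / rho) *
                ln (2 * enorm (g x0) ^+ 2 / (Num.min rho mu * eps)))),
      rho = mu ->
      [/\ gamma_rate beta mu rho = 7 / 8,
          theta_rate beta L rho = L / (L + mu / 2) &
          reaches_within X f beta x0 s y eps
            (C * (B%:R * (1 + L / mu) *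
                    (1 + ln ((f x0 - min_value X f) / eps) +
                     ln (2 * enorm (g x0) ^+ 2 / (mu * eps)))))] &
      rho = L ->
      [/\ theta_rate beta L rho = 2 / 3,
          gamma_rate beta mu rho = 1 - 1 / (2 * Num.max 2 (4 * L / mu)) &
          reaches_within X f beta x0 s y eps
            (C * (B%:R * (1 + L / mu) *
                    (1 + ln ((1 + L / mu) * (f x0 - min_value X f) / eps)) +
                  B%:R * ln (2 * enorm (g x0) ^+ 2 / (Num.min L mu * eps))))]].
Proof.
exists 192; first by rewrite ltr0n.
move=> n X f g k L P mu x0 rho beta B eps s y.
move=> _ _ convX convf _ fmin oracle k_gt0 L_gt0 [_ cover _] pieces growthE mu_gt0.
move=> Xx0 kB eps_gt0 eps_lt betaE lo hi run; rewrite betaE in run *.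
have growth := growth_modulus_growth growthE fmin.
have rho_gt0 : 0 < rho by apply: lt_le_trans lo; rewrite lt_min mu_gt0.
have core := lmpbm_complexity convX oracle rho_gt0 Xx0 run L_gt0 cover pieces kB
  mu_gt0 convf fmin growth eps_gt0 eps_lt lo hi k_gt0.
have [l1_ge0 l2_ge0] := log_terms_ge0 convX oracle rho_gt0 Xx0 run
  mu_gt0 convf fmin growth eps_gt0 eps_lt.
set D := f x0 - min_value X f in core eps_lt l1_ge0 *.
set l1 := ln (D / eps) in core l1_ge0 *.
set l2 := ln (_ / (Num.min rho mu * eps)) in core l2_ge0 *.
have D_gt0 : 0 < D by exact: lt_trans eps_lt.
have B1 : 1 <= B%:R :> R by rewrite ler1n (leq_trans k_gt0).
have Lmu : 0 < L / mu by rewrite divr_gt0.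
have Lrho : 0 < L / rho by rewrite divr_gt0.
have Ll1 : 0 <= L / mu * l1 by rewrite mulr_ge0// ltW.
have Ll2 : 0 <= L / rho * l2 by rewrite mulr_ge0// ltW.
have weaken T : 3 + 192 * (1 + L / mu) * l1 + 4 * (1 + L / rho) * l2 <= T ->
    reaches_within X f (1 / 2) x0 s y eps (B%:R * T).
  move=> le_T; have [t [st ft qt]] := core; exists t; split=> //.
  by apply: le_trans qt _; rewrite ler_pM2l// (lt_le_trans ltr01).
have l1_mono a : 1 <= a -> l1 <= ln (a * D / eps).
  move=> a1; have a0 : 0 < a by exact: lt_le_trans a1.
  rewrite ler_ln ?posrE ?divr_gt0 ?mulr_gt0//.
  by rewrite ler_pM2r ?invr_gt0// ler_peMl// ltW.
split.
- rewrite -!mulrA -mulrDr mulrCA; apply: weaken.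
  have q_gt0 : 0 < Num.min 1 (mu / rho) by rewrite lt_min ltr01 divr_gt0.
  have := l1_mono (Num.min 1 (mu / rho))^-1; rewrite invf_ge1// ge_min lexx.
  have -> : (Num.min 1 (mu / rho))^-1 * D / eps = D / (eps * Num.min 1 (mu / rho)).
    by rewrite invfM; ring.
  move=> /(_ isT); set l1' := ln _ => l1l.
  have : L / mu * l1 <= L / mu * l1' by rewrite ler_pM2l.
  lra.
- move=> rhoE; split.
  + by rewrite /gamma_rate rhoE mulfK ?gt_eqF// max_r ?ler_nat//; field.
  + by rewrite /theta_rate rhoE; congr (_ / (_ + _)); field.
  + have l2E : l2 = ln (2 * enorm (g x0) ^+ 2 / (mu * eps)).
      by rewrite /l2 rhoE minxx.
    rewrite -l2E -!mulrA mulrCA; apply: weaken.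
    have -> : L / rho = L / mu by rewrite rhoE.
    have := mulr_ge0 (ltW Lmu) l2_ge0; lra.
- move=> rhoE; split.
  + by rewrite /theta_rate rhoE; field; lra.
  + by rewrite /gamma_rate rhoE; congr (1 - _); field; rewrite gt_eqF// lt_max ltr0n.
  + rewrite -rhoE -/l2.
    rewrite -[B%:R * (1 + rho / mu) * _]mulrA -mulrDr mulrCA; apply: weaken.
    have := l1_mono (1 + L / mu); rewrite lerDl ltW// rhoE => /(_ isT).
    set l1' := ln _ => l1l.
    have : L / mu * l1 <= L / mu * l1' by rewrite ler_pM2l.
    rewrite divff ?gt_eqF//; lra.
Qed.
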